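(* An atomic domain that contains a nonzero nonunit comparable element is a discrete valuation ring (DVR).
   Context: A nonzero element $c$ of an integral domain $D$ is comparable in $D$ if for every $x\in D$ one has $cD\subseteq xD$ or $xD\subseteq cD$. An integral domain is atomic if every nonzero nonunit is a finite product of irreducible elements (atoms). DVR means a rank one discrete valuation domain. *)

(* Defs.v *)
(* MathComp, with set inclusion taken from MathComp-Analysis' classical_sets. *)
From mathcomp Require Import all_boot all_order all_algebra.
From mathcomp Require Import classical_sets.

Set Implicit Arguments.
Unset Strict Implicit.
Unset Printing Implicit Defensive.

Import Order.TTheory GRing.Theory Num.Theory.

Local Open Scope classical_set_scope.
Local Open Scope ring_scope.

Definition principal_ideal (D : idomainType) (c : D) : set D :=
  [set c * y | y in [set: D]].

Definition comparable_element (D : idomainType) (c : D) : Prop :=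
  c != 0 /\
  forall x : D, principal_ideal c `<=` principal_ideal x \/
                principal_ideal x `<=` principal_ideal c.

Definition atom (D : idomainType) (a : D) : Prop :=
  [/\ a != 0, a \isn't a GRing.unit &
      forall x y : D, a = x * y ->
        x \is a GRing.unit \/ y \is a GRing.unit].

(* The empty product is harmless here: it is a unit. *)
Definition atomic_domain (D : idomainType) : Prop :=
  forall x : D, x != 0 -> x \isn't a GRing.unit ->
    exists s : seq D, (forall a, a \in s -> atom a) /\ x = \prod_(a <- s) a.

(* A valuation with value group exactly Z (surjectivity excludes the trivial
   valuation).  It is constrained only on nonzero elements; the value v 0 is
   junk, standing for infinity. *)
Definition discrete_valuation (K : fieldType) (v : K -> int) : Prop :=
  [/\ forall x y, x != 0 -> y != 0 -> v (x * y) = v x + v y,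
      forall x y, x != 0 -> y != 0 -> x + y != 0 ->
        Num.min (v x) (v y) <= v (x + y) &
      forall n : int, exists2 x, x != 0 & v x = n].

(* D is the valuation ring, in its field of fractions, of a valuation with
   value group Z.  In particular a field is not a DVR. *)
Definition is_DVR (D : idomainType) : Prop :=
  exists2 v : {fraction D} -> int, discrete_valuation v &
    forall z : {fraction D}, z != 0 ->
      ((exists d : D, z = FracField.tofrac d) <-> 0 <= v z).

(* Main.v *)
Require Import Defs.
From mathcomp Require Import all_boot all_order all_algebra.
From mathcomp Require Import boolp classical_sets.
Local Open Scope ring_scope.

(** Comparability of c says that each x divides c or is divided by c.  It
    passes to every factor p of c = p * r: compare c with x * r and cancel r
    ([comparable_factor]).  In an atomic domain a nonzero nonunit comparable
    element therefore has a comparable atom p as a factor.  A nonunit dividing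
    an atom is an associate of it, so comparability of p forces p to divide
    every nonunit ([comparable_atom_dvd]); in particular all atoms are
    associates of p, and atomicity turns every nonzero element into u * p ^ n
    with u a unit ([atomic_unit_pow]).

    Such a p is a uniformizer.  Every nonzero fraction is u * p ^ n for a unit
    u of D and a unique n : int, and sending it to n is the required valuation
    ([uniformizer_DVR]).  The ultrametric inequality comes from factoring out
    the smaller power of p: what remains is an element of D, whose exponent is
    nonnegative. *)

Set Implicit Arguments.
Unset Strict Implicit.
Unset Printing Implicit Defensive.

Import Order.TTheory GRing.Theory Num.Theory.

Local Notation "x %:F" := (FracField.tofrac x).

Section Comparable.

Variable D : idomainType.
Implicit Types c p r x y u : D.

Lemma principal_ideal_sub c x :
  (principal_ideal c `<=` principal_ideal x)%classic <-> exists y, c = x * y.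
Proof.
split=> [cx|[y ->] _ [z _ <-]]; last by exists (y * z); rewrite ?mulrA.
have [y _ xyc] : principal_ideal x c by apply: cx; exists 1; rewrite ?mulr1.
by exists y.
Qed.

Lemma comparable_elementP c :
  comparable_element c <->
  c != 0 /\ forall x, (exists y, c = x * y) \/ (exists y, x = c * y).
Proof.
by split=> -[c0 cmp]; split=> // x;
  case: (cmp x) => /principal_ideal_sub; [left|right|left|right].
Qed.

(** Multiplying by r and cancelling it moves each comparison between x and p
    to one between x * r and p * r. *)
Lemma comparable_factor p r :
  comparable_element (p * r) -> comparable_element p.
Proof.
move=> /comparable_elementP[]; rewrite mulf_eq0 negb_or => /andP[p0 r0] cmp.
apply/comparable_elementP; split=> // x.
by case: (cmp (x * r)) => -[y]; rewrite mulrAC => /(mulIf r0) ->;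
  [left|right]; exists y.
Qed.

Lemma atomic_comparable_atom c : atomic_domain D ->
  c \isn't a GRing.unit -> comparable_element c ->
  exists2 p : D, atom p & comparable_element p.
Proof.
move=> atomicD cU cmp; have [c0 _] := cmp.
have [[|p s] [atoms c_prod]] := atomicD c c0 cU.
  by rewrite c_prod big_nil unitr1 in cU.
exists p; first by apply: atoms; rewrite mem_head.
by rewrite c_prod big_cons in cmp; exact: comparable_factor cmp.
Qed.

(** A nonunit x that divides the atom p is an associate of p, so either
    outcome of the comparison makes p divide x: p generates the maximal
    ideal. *)
Lemma comparable_atom_dvd p x : atom p -> comparable_element p ->
  x \isn't a GRing.unit -> exists y, x = p * y.
Proof.
move=> [p0 _ irr] /comparable_elementP[_ cmp] xU.
case: (cmp x) => // -[y pE]; case: (irr x y pE) => yU.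
  by rewrite yU in xU.
by exists y^-1; rewrite pE mulrK.
Qed.

Lemma atomic_unit_pow p x : atomic_domain D ->
  atom p -> comparable_element p -> x != 0 ->
  exists2 u, u \is a GRing.unit & exists n : nat, x = u * p ^+ n.
Proof.
move=> atomicD atom_p cmp x0; have [xU|xU] := boolP (x \is a GRing.unit).
  by exists x => //; exists 0%N; rewrite expr0 mulr1.
have [s [atoms ->]] := atomicD x x0 xU.
elim: s atoms => [|a s IHs] atoms.
  by exists 1; rewrite ?unitr1 //; exists 0%N; rewrite big_nil mul1r.
have [b b_s|u uU [n sE]] := IHs.
  by apply: atoms; rewrite inE b_s orbT.
have [_ aU irr] : atom a by apply: atoms; rewrite mem_head.
have [y aE] := comparable_atom_dvd atom_p cmp aU.
have yU : y \is a GRing.unit.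
  by case: (irr p y aE) => // pU; case: atom_p; rewrite pU.
exists (y * u); first by rewrite unitrM yU.
by exists n.+1; rewrite big_cons sE aE [p * y]mulrC mulrACA -exprS.
Qed.

End Comparable.

Lemma fractionE (D : idomainType) (z : {fraction D}) :
  exists x y : D, y != 0 /\ z = x%:F / y%:F.
Proof.
elim/quotW: z => f; exists \n_f, \d_f; split; first exact: denom_ratioP.
have d0 : (\d_f)%:F != 0 by rewrite tofrac_eq0 denom_ratioP.
apply: (canRL (mulfK d0)); unlock FracField.tofrac.
rewrite -[LHS]FracField.pi_mul; apply/eqmodP.
rewrite /= FracField.equivfE /FracField.mulf.
by rewrite !numden_Ratio ?mulr1 ?oner_neq0 ?denom_ratioP // mulrC.
Qed.

Section Uniformizer.

Variables (D : idomainType) (p : D).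
Hypotheses (p0 : p != 0) (pU : p \isn't a GRing.unit).
Hypothesis unit_pow : forall x : D, x != 0 ->
  exists2 u, u \is a GRing.unit & exists n : nat, x = u * p ^+ n.

Implicit Types z w : {fraction D}.

Definition has_order z (n : int) :=
  exists2 u : D, u \is a GRing.unit & z = u%:F * p%:F ^ n.

Let pF0 : p%:F != 0. Proof. by rewrite tofrac_eq0. Qed.

Lemma has_order_neq0 z n : has_order z n -> z != 0.
Proof.
move=> [u uU ->]; rewrite mulf_neq0 ?expfz_neq0 // tofrac_eq0.
by apply: contraTneq uU => ->; rewrite unitr0.
Qed.

Lemma has_orderM z w m n :
  has_order z m -> has_order w n -> has_order (z * w) (m + n).
Proof.
move=> [u uU ->] [t tU ->]; exists (u * t); first by rewrite unitrM uU.
by rewrite expfzDr // tofracM mulrACA.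
Qed.

Lemma has_orderV z n : has_order z n -> has_order z^-1 (- n).
Proof.
move=> [u uU ->]; exists u^-1; first by rewrite unitrV.
by rewrite invfM -invr_expz rmorphV.
Qed.

Lemma has_order_exp (n : int) : has_order (p%:F ^ n) n.
Proof. by exists 1; rewrite ?unitr1 // tofrac1 mul1r. Qed.

Lemma has_order_tofrac (x : D) :
  x != 0 -> exists n : nat, has_order x%:F n%:Z.
Proof.
move=> /unit_pow[u uU [n ->]]; exists n, u => //.
by rewrite tofracM tofracXn.
Qed.

Lemma has_order_total z : z != 0 -> exists n, has_order z n.
Proof.
have [x [y [y0 ->]]] := fractionE z.
rewrite mulf_eq0 negb_or tofrac_eq0 => /andP[x0 _].
have [m xm] := has_order_tofrac x0; have [n yn] := has_order_tofrac y0.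
by exists (m%:Z - n%:Z); exact: has_orderM xm (has_orderV yn).
Qed.

Lemma has_order_ge0 z (n : int) :
  has_order z n -> 0 <= n -> exists x : D, z = x%:F.
Proof.
move=> [u _ ->]; case: n => // n _.
by exists (u * p ^+ n); rewrite tofracM tofracXn.
Qed.

(** A positive power of p is never a unit of D, so 1 has no order but 0. *)
Lemma has_order1 (n : int) : has_order 1 n -> n = 0.
Proof.
have pos (k : nat) : has_order 1 k%:Z -> k = 0%N.
  case: k => // k [u uU /esym/eqP].
  rewrite -exprnP -tofracXn -tofracM -tofrac1 tofrac_eq exprS mulrCA => /eqP pE.
  by case/unitrPr: pU; exists (u * p ^+ k).
case: n => [n /pos -> //|n]; rewrite NegzE => /has_orderV.
by rewrite invr1 opprK => /pos.
Qed.

Lemma has_order_inj z m n : has_order z m -> has_order z n -> m = n.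
Proof.
move=> zm zn; apply/eqP; rewrite -subr_eq0; apply/eqP/has_order1.
by rewrite -(mulfV (has_order_neq0 zm)); exact: has_orderM zm (has_orderV zn).
Qed.

Lemma has_order_tofrac_ge0 (x : D) n : has_order x%:F n -> 0 <= n.
Proof.
move=> xn; have := has_order_neq0 xn; rewrite tofrac_eq0 => x0.
by have [k xk] := has_order_tofrac x0; rewrite (has_order_inj xn xk).
Qed.

Lemma has_orderD z w m n k : m <= n ->
  has_order z m -> has_order w n -> has_order (z + w) k -> m <= k.
Proof.
move=> mn zm wn zwk; rewrite -subr_ge0.
(* Divided by p ^ m, both summands lie in D, hence so does their sum. *)
have quo y l : m <= l -> has_order y l -> exists x : D, y * p%:F ^ (- m) = x%:F.
  move=> ml yl; apply: (@has_order_ge0 _ (l - m)); last by rewrite subr_ge0.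
  exact: has_orderM yl (has_order_exp _).
have [[x zx] [y wy]] := (quo z m (lexx m) zm, quo w n mn wn).
apply: (@has_order_tofrac_ge0 (x + y)).
by rewrite tofracD -zx -wy -mulrDl; exact: has_orderM zwk (has_order_exp _).
Qed.

Theorem uniformizer_DVR : is_DVR D.
Proof.
have total z : exists n, z != 0 -> has_order z n.
  have [->|/has_order_total[n zn]] := eqVneq z 0; first by exists 0.
  by exists n.
have [v vP] := choice total.
have vE z n : has_order z n -> v z = n.
  by move=> zn; exact: has_order_inj (vP z (has_order_neq0 zn)) zn.
exists v => [|z /vP zv].
  split=> [z w z0 w0|z w z0 w0 zw0|n].
  - by apply: vE; apply: has_orderM; exact: vP.
  - have [[zv wv] zwv] := (vP z z0, vP w w0, vP _ zw0).
    have [zw|/ltW wz] := leP (v z) (v w); first exact: has_orderD zv wv zwv.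
    by rewrite addrC in zwv *; exact: has_orderD wv zv zwv.
  - by exists (p%:F ^ n); [exact: expfz_neq0|exact: vE (has_order_exp n)].
split=> [[x zx]|]; last exact: has_order_ge0 zv.
by rewrite {1}zx in zv; exact: has_order_tofrac_ge0 zv.
Qed.

End Uniformizer.

Theorem corollary4p12 (D : idomainType) (atomicD : atomic_domain D)
    (comparableD : exists c : D,
      [/\ c != 0, c \isn't a GRing.unit & comparable_element c]) :
  is_DVR D.
Proof.
have [c [_ cU cmp_c]] := comparableD.
have [p atom_p cmp_p] := atomic_comparable_atom atomicD cU cmp_c.
have [p0 pU _] := atom_p.
by apply: (uniformizer_DVR p0 pU) => x; exact: atomic_unit_pow.
Qed.
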